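(* Let $(\mathfrak b,\{\cdot,\cdot\})$ be a Banach Lie-Poisson space which splits as a direct sum $\mathfrak b=\mathfrak b_1\oplus\mathfrak b_2$ of closed Banach subspaces. For $j=1,2$ let $R_j:\mathfrak b\to\mathfrak b$ be the projector onto $\mathfrak b_j$ defined by the splitting, $\iota_j:\mathfrak b_j\hookrightarrow\mathfrak b$ the inclusion, and $\pi_j:\mathfrak b\to\mathfrak b_j$ the projection (so $\iota_j\circ\pi_j=R_j$). Assume that $\operatorname{im}R_1^*$ and $\operatorname{im}R_2^*$ are Banach Lie subalgebras of $\mathfrak b^*$. Let $R=\frac12(R_1-R_2)$, $$\{f,g\}_R(b)=\langle[R^*Df(b),Dg(b)]+[Df(b),R^*Dg(b)],b\rangle\quad (f,g\in C^\infty(\mathfrak b)),$$ and let $\mathfrak b_j$ carry the coinduced bracket $\{f,g\}_j^{\rm coind}=\{f\circ\pi_j,g\circ\pi_j\}\circ\iota_j$. Then: (i) The Casimir functions on $(\mathfrak b,\{\cdot,\cdot\})$ are in involution on $(\mathfrak b,\{\cdot,\cdot\}_R)$ and restrict to functions in involution on $\mathfrak b_j$, $j=1,2$ (that is, $\{F\circ\iota_j,H\circ\iota_j\}_j^{\rm coind}=0$ for Casimir functions $F,H$). (ii) If $H$ is a Casimir function on $\mathfrak b$, then its restriction $H\circ\iota_j$ to $\mathfrak b_j$ has the Hamiltonian vector field $$X_{H\circ\iota_1}(b_1)=\pi_1\big(\operatorname{ad}^*_{R_2^*DH(\iota_1(b_1))}\iota_1(b_1)\big),\qquad X_{H\circ\iota_2}(b_2)=\pi_2\big(\operatorname{ad}^*_{R_1^*DH(\iota_2(b_2))}\iota_2(b_2)\big)$$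 for any $b_1\in\mathfrak b_1$ and $b_2\in\mathfrak b_2$.
   Context: All spaces are real. A Banach Lie-Poisson space is a Banach space $\mathfrak b$ whose dual $\mathfrak b^*$ is a Banach Lie algebra $(\mathfrak b^*,[\cdot,\cdot])$ (continuous Lie bracket) with $\operatorname{ad}^*_x\mathfrak b\subset\mathfrak b\subset\mathfrak b^{**}$ for all $x\in\mathfrak b^*$, where $\operatorname{ad}_xy=[x,y]$ and $\langle\operatorname{ad}_x^*b,y\rangle=\langle b,[x,y]\rangle$; its Poisson bracket is $\{f,h\}(b)=\langle[Df(b),Dh(b)],b\rangle$ for $f,h\in C^\infty(\mathfrak b)$, where $Df(b)\in\mathfrak b^*$ is the Fréchet derivative. The Hamiltonian vector field $X_h$ is determined by $\langle Df(b),X_h(b)\rangle=\{f,h\}(b)$ for all $f$. A Casimir function is an $H\in C^\infty(\mathfrak b)$ with $\{f,H\}=0$ for all $f\in C^\infty(\mathfrak b)$, i.e. $\operatorname{ad}^*_{DH(b)}b=0$ for all $b\in\mathfrak b$. Functions are in involution if their Poisson bracket vanishes. The Hamiltonian vector fields on $\mathfrak b_j$ in (ii) are taken with respect to $\{\cdot,\cdot\}_j^{\rm coind}$, which under the stated hypotheses is a Banach Lie-Poisson bracket on $\mathfrak b_j$. $R_j^*:\mathfrak b^*\to\mathfrak b^*$ denotes the dual of $R_j$. *)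

(* Defs.v *)
From HB Require Import structures.
From mathcomp Require Import all_boot all_order all_algebra.
From mathcomp Require Import all_classical all_reals all_analysis.
From mathcomp Require Import ring.

Set Implicit Arguments.
Unset Strict Implicit.
Unset Printing Implicit Defensive.

Import Order.TTheory GRing.Theory Num.Theory.
Import numFieldNormedType.Exports.

Local Open Scope classical_set_scope.
Local Open Scope ring_scope.

Section ContinuousLinearMaps.
Context {R : realType} (V W : normedModType R).

Definition clin_pred : {pred V -> W} := [pred f | `[< linear f /\ continuous f >]].

Record clin := CLin { clin_fun :> V -> W; clin_funP : clin_fun \in clin_pred }.

HB.instance Definition _ := [isSub for clin_fun].
HB.instance Definition _ := [Choice of clin by <:].

Lemma clin_linear (f : clin) : linear f.
Proof. by case: f => f /= /asboolP[]. Qed.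

Lemma clin_continuous (f : clin) : continuous f.
Proof. by case: f => f /= /asboolP[]. Qed.

HB.instance Definition _ (f : clin) :=
  GRing.isLinear.Build R V W *:%R f (clin_linear f).

Lemma clin_submod_closed : submod_closed clin_pred.
Proof.
split=> [|a f g]; rewrite !inE.
  by split=> [b x y|]; [rewrite scaler0 addr0|exact: cst_continuous].
move=> [fl fc] [gl gc]; split=> [b x y|x].
  rewrite -![(_ + _) _]/(a *: f _ + g _) fl gl !scalerDr !scalerA mulrC.
  by rewrite addrACA.
apply: (@continuousD _ _ _ (a *: f) g x); last exact: gc.
by apply: continuousZr; exact: fc.
Qed.

HB.instance Definition _ := GRing.isSubmodClosed.Build _ _ clin_pred
  clin_submod_closed.
HB.instance Definition _ := [SubChoice_isSubLmodule of clin by <:].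

Lemma clinP (f g : clin) : f = g <-> f =1 g.
Proof. by split=> [->//|fg]; exact/val_inj/funext. Qed.

(* The set is bounded because f is continuous, and contains `|f 0| = 0. *)
Definition opnorm (f : clin) : R := sup [set `|f x| | x in [set x | `|x| <= 1]].

Lemma clin_bounded (f : clin) : exists2 M, 0 < M & forall x, `|f x| <= M * `|x|.
Proof.
have /linear_boundedP/pinfty_ex_gt0[M M0 fM] : bounded_near f (nbhs (0 : V)).
  by apply/linear_bounded_continuous; exact: clin_continuous.
by exists M.
Qed.

Lemma opnorm_has_sup (f : clin) :
  has_sup [set `|f x| | x in [set x | `|x| <= 1]].
Proof.
split; first by exists `|f 0|; exists 0 => //=; rewrite normr0.
have [M M0 fM] := clin_bounded f; exists M => _ [x x1 <-].
by rewrite (le_trans (fM x))// ler_piMr// ltW.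
Qed.

Lemma opnorm_ge0 (f : clin) : 0 <= opnorm f.
Proof.
have -> : 0 = `|f 0| by rewrite linear0 normr0.
apply: ub_le_sup; first by case: (opnorm_has_sup f).
by exists 0 => //=; rewrite normr0.
Qed.

Lemma opnorm_le (f : clin) x : `|f x| <= opnorm f * `|x|.
Proof.
have [->|x0] := eqVneq x 0; first by rewrite linear0 !normr0 mulr0.
have nx : 0 < `|x| by rewrite normr_gt0.
rewrite -ler_pdivrMr//.
have -> : `|f x| / `|x| = `|f (`|x|^-1 *: x)|.
  by rewrite linearZ normrZ normfV normr_id mulrC.
apply: ub_le_sup; first by case: (opnorm_has_sup f).
by exists (`|x|^-1 *: x) => //=; rewrite normrZ normfV normr_id mulVf ?gt_eqF.
Qed.

Lemma opnorm_lub (f : clin) M : 0 <= M -> (forall x, `|f x| <= M * `|x|) ->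
  opnorm f <= M.
Proof.
move=> M0 fM; apply: ge_sup; first by case: (opnorm_has_sup f).
by move=> _ [x x1 <-]; rewrite (le_trans (fM x))// ler_piMr.
Qed.

Let opnormD (f g : clin) : opnorm (f + g) <= opnorm f + opnorm g.
Proof.
apply: opnorm_lub => [|x]; first by rewrite addr_ge0// opnorm_ge0.
by rewrite (le_trans (ler_normD _ _))// mulrDl lerD// opnorm_le.
Qed.

Let opnormZ (a : R) (f : clin) : opnorm (a *: f) = `|a| * opnorm f.
Proof.
have le (c : R) (g : clin) : opnorm (c *: g) <= `|c| * opnorm g.
  apply: opnorm_lub => [|x]; first by rewrite mulr_ge0// opnorm_ge0.
  rewrite -[(c *: g) x]/(c *: g x) normrZ -mulrA ler_wpM2l//.
  exact: opnorm_le.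
apply/eqP; rewrite eq_le le /=.
have [->|a0] := eqVneq a 0; first by rewrite normr0 mul0r opnorm_ge0.
rewrite -ler_pdivlMl ?normr_gt0// -normfV.
by rewrite -[X in opnorm X <= _](scalerK a0) le.
Qed.

Let opnorm0_eq0 (f : clin) : opnorm f = 0 -> f = 0.
Proof.
move=> f0; apply/clinP => x; apply/eqP; rewrite -normr_le0.
by rewrite (le_trans (opnorm_le f x))// f0 mul0r.
Qed.

HB.instance Definition _ := Lmodule_isNormed.Build R clin
  opnormD opnormZ opnorm0_eq0.

Lemma clin_normE (f : clin) : `|f| = opnorm f.
Proof. by []. Qed.

End ContinuousLinearMaps.
Arguments clin_pred {R} V W.

Section CompleteContinuousLinearMaps.
Context {R : realType} (V : normedModType R) (W : completeNormedModType R).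

Lemma clin_complete (F : set_system (clin V W)) :
  ProperFilter F -> cauchy F -> cvg F.
Proof.
move=> FF /cauchy_ballP Fc.
have Fc' (e : R) : 0 < e -> exists f0 : clin V W, F [set g : clin V W | `|f0 - g| < e].
  move=> e0; have /cauchyP/(_ e e0)[f0 Ff0] : cauchy F by apply/cauchy_ballP.
  by exists f0; move: Ff0; rewrite -ball_normE.
pose ev (x : V) := (fun g : clin V W => g x) @ F.
have evP (x : V) : ProperFilter (ev x) by exact: fmap_proper_filter.
have ev_cvg (x : V) : cvg (ev x).
  apply: cauchy_cvg; apply: cauchy_exP => e e0.
  have d0 : 0 < e / (`|x| + 1) by rewrite divr_gt0// ltr_wpDl.
  have [f0 Ff0] := Fc' _ d0; exists (f0 x).
  rewrite -ball_normE -[ev x _]/(F [set g : clin V W | `|f0 x - g x| < e]).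
  apply: (filterS _ Ff0) => g /= f0g.
  rewrite -[f0 x - g x]/((f0 - g : clin V W) x) (le_lt_trans (opnorm_le _ _))//.
  rewrite (@le_lt_trans _ _ (e / (`|x| + 1) * `|x|))//.
    by rewrite ler_wpM2r// ltW.
  by rewrite mulrAC ltr_pdivrMr ?ltr_wpDl// ltr_pM2l// ltrDl.
pose l (x : V) : W := lim (ev x).
have lE (x : V) : (fun g : clin V W => g x) @ F --> l x by exact: ev_cvg.
have l_lin : linear l.
  move=> a x y; apply: cvg_lim => //.
  rewrite (_ : (fun g : clin V W => _) =
      (fun g : clin V W => a *: g x + g y)); last first.
    by apply/funext => g; rewrite linearP.
  by apply: cvgD; [apply: cvgZl_tmp|]; exact: lE.
have l_near (e : R) (f0 : clin V W) : 0 < e -> F [set g : clin V W | `|f0 - g| < e] ->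
    forall x, `|f0 x - l x| <= e * `|x|.
  move=> e0 Ff0 x.
  have : (fun g : clin V W => f0 x - g x) @ F --> f0 x - l x.
    by apply: cvgB => //; exact: cvg_cst.
  move=> /cvg_norm /cvgr_to_le; apply; apply: (filterS _ Ff0) => g /= f0g.
  rewrite -[f0 x - g x]/((f0 - g : clin V W) x) (le_trans (opnorm_le _ _))//.
  by rewrite ler_wpM2r// ltW.
have l_bnd : exists M, forall x, `|l x| <= M * `|x|.
  have [f0 Ff0] := Fc' 1 ltr01; exists (1 + `|f0|) => x.
  rewrite -[l x](subKr (f0 x)) (le_trans (ler_normB _ _))// mulrDl addrC lerD//.
    exact: l_near.
  exact: opnorm_le.
have l_cont : continuous l.
  pose l' : {linear V -> W} := HB.pack l (GRing.isLinear.Build _ _ _ _ _ l_lin).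
  apply: (@bounded_linear_continuous _ _ _ l'); apply/linear_boundedP.
  have [M lM] := l_bnd; near=> r => x; rewrite (le_trans (lM x))//.
  by rewrite ler_wpM2r//; near: r; exact: nbhs_pinfty_ge.
have lP : (l : V -> W) \in clin_pred V W by apply/asboolP.
apply/cvg_ex; exists (CLin lP); apply/cvgrPdist_le => e e0.
have e20 : 0 < e / 2 by rewrite divr_gt0.
have [f0 Ff0] := Fc' _ e20.
apply: (filterS _ Ff0) => g /= f0g.
rewrite -(subrKA f0) (splitr e) (le_trans (ler_normD _ _))// lerD ?(ltW f0g)//.
rewrite distrC; apply: opnorm_lub => [|x]; first exact: ltW.
exact: (l_near _ _ e20 Ff0).
Unshelve. all: by end_near. Qed.

HB.instance Definition _ := Uniform_isComplete.Build (clin V W) clin_complete.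

End CompleteContinuousLinearMaps.

Section ClosedSubspaces.
Context {R : realType} (V : normedModType R).

Record closed_subspace := ClosedSubspace {
  subspace_mem : {pred V};
  subspace_submod : submod_closed subspace_mem;
  subspace_closed : closed [set x | x \in subspace_mem] }.

Variable S : closed_subspace.

HB.instance Definition _ := GRing.isSubmodClosed.Build R V (subspace_mem S)
  (subspace_submod S).

Record subspace_of := SubspaceOf {
  subspace_val : V; subspace_valP : subspace_val \in subspace_mem S }.

HB.instance Definition _ := [isSub for subspace_val].
HB.instance Definition _ := [Choice of subspace_of by <:].
HB.instance Definition _ := [SubChoice_isSubLmodule of subspace_of by <:].

Let sub_normD (x y : subspace_of) : `|val (x + y)| <= `|val x| + `|val y|.
Proof. exact: ler_normD. Qed.

Let sub_normZ (a : R) (x : subspace_of) : `|val (a *: x)| = `|a| * `|val x|.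
Proof. exact: normrZ. Qed.

Let sub_norm0_eq0 (x : subspace_of) : `|val x| = 0 -> x = 0.
Proof. by move=> /normr0_eq0 x0; exact/val_inj. Qed.

HB.instance Definition _ := Lmodule_isNormed.Build R subspace_of
  sub_normD sub_normZ sub_norm0_eq0.

Lemma incl_clin_pred : subspace_val \in clin_pred subspace_of V.
Proof.
apply/asboolP; split=> //.
apply: (@bounded_linear_continuous _ _ _ (val : {linear subspace_of -> V})).
apply/linear_boundedP; near=> r => x; rewrite -[leLHS]mul1r.
by rewrite ler_wpM2r//; near: r; exact: nbhs_pinfty_ge.
Unshelve. all: by end_near. Qed.

Definition subspace_incl : clin subspace_of V := CLin incl_clin_pred.

End ClosedSubspaces.
Coercion subspace_of : closed_subspace >-> Sortclass.

Section CompleteSubspaces.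
Context {R : realType} (V : completeNormedModType R) (S : closed_subspace V).

Lemma subspace_complete (F : set_system S) :
  ProperFilter F -> cauchy F -> cvg F.
Proof.
move=> FF Fc.
have vF : ProperFilter ((subspace_incl S : S -> V) @ F) by exact: fmap_proper_filter.
have /cvg_ex[/= l Fl] : cvg ((subspace_incl S : S -> V) @ F).
  apply: cauchy_cvg; apply: cauchy_exP => e e0.
  have /cauchyP/(_ e e0)[x] : cauchy F by [].
  by rewrite -ball_normE; exists (subspace_incl S x); rewrite -ball_normE.
have lS : l \in subspace_mem S.
  have := @closed_cvg _ _ F _ (subspace_incl S) _ (@subspace_closed _ _ S) _ l Fl.
  by apply; apply: nearW => x; exact: subspace_valP.
apply/cvg_ex; exists (SubspaceOf lS); apply/cvgrPdist_lt => e e0.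
by move/cvgrPdist_lt: Fl => /(_ e e0).
Qed.

HB.instance Definition _ := Uniform_isComplete.Build S subspace_complete.

End CompleteSubspaces.

Section DirectSums.
Context {R : realType} (V : completeNormedModType R).
Implicit Types S T : closed_subspace V.

(* Only algebraic: as S and T are closed and V is complete, the projections are
   automatically continuous (proj_fun_bounded below). *)
Definition direct_sum S T :=
  forall x : V, exists! p : S * T, x = subspace_incl S p.1 + subspace_incl T p.2.

Lemma direct_sumC S T : direct_sum S T -> direct_sum T S.
Proof.
move=> ST x; have [[s t] [/= xE st]] := ST x; exists (t, s); split=> /=.
  by rewrite addrC.
by move=> [t' s'] /=; rewrite addrC => xE'; have [-> ->] := st (s', t') xE'.
Qed.

Definition proj_fun S T (ST : direct_sum S T) (x : V) : S :=
  (projT1 (cid (ST x))).1.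

Section Projection.
Variables (S T : closed_subspace V) (ST : direct_sum S T).
Local Notation p := (proj_fun ST).

Lemma proj_funP x : exists t : T, x = subspace_incl S (p x) + subspace_incl T t.
Proof. by rewrite /proj_fun; case: cid => -[s t] /= [-> _]; exists t. Qed.

Lemma proj_fun_uniq x (s : S) (t : T) :
  x = subspace_incl S s + subspace_incl T t -> p x = s.
Proof.
rewrite /proj_fun; case: cid => -[s' t'] /= [_ u] xE.
by have [-> _] := u (s, t) xE.
Qed.

Lemma proj_fun_linear : linear p.
Proof.
move=> a x y; have [t xE] := proj_funP x; have [u yE] := proj_funP y.
apply: (@proj_fun_uniq _ _ (a *: t + u)).
by rewrite {1}xE {1}yE !linearP /= scalerDr addrACA.
Qed.

HB.instance Definition _ := GRing.isLinear.Build R V S *:%R p proj_fun_linear.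

(* Baire category step of the open mapping theorem: the set {|p x| <= n} is
   dense in a ball for some n. *)
Lemma proj_fun_approx : exists2 C : R, 0 < C &
  forall x : V, exists a : V, `|p a| <= C * `|x| /\ `|x - a| <= `|x| / 2.
Proof.
pose A (n : nat) : set V := [set x | `|p x| <= n%:R].
have [n nO] : exists n, ~ dense (~` closure (A n)).
  apply: contrapT => /forallNP nO.
  have : dense (\bigcap_n ~` closure (A n)).
    apply: Baire => n; split; last exact: contrapT (nO n).
    by rewrite openC; exact: closed_closure.
  move=> /(_ setT) []; [by exists 0|exact: openT|].
  move=> x [_ /(_ (Num.truncn `|p x|).+1 I)]; apply; apply: subset_closure => /=.
  exact/ltW/truncnS_gt.
have [x0 [r r0 Hr]] : exists x0, exists2 r : R, 0 < r &
    ball x0 r `<=` closure (A n).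
  have [U [[x [oU xU]] UA]] := denseNE nO.
  have /nbhs_ballP[r r0 rU] : nbhs x U by exact: open_nbhs_nbhs.
  exists x, r => // y /rU Uy; apply: contrapT => nAy.
  by have : (U `&` ~` closure (A n)) y by []; rewrite UA.
have apx y : `|y| < r -> exists2 a, A n a & `|x0 + y - a| < r / 8.
  move=> yr; have /Hr/(_ (ball (x0 + y) (r / 8))) : ball x0 r (x0 + y).
    by rewrite -ball_normE /= opprD addNKr normrN.
  case; first by apply: nbhsx_ballx; rewrite divr_gt0.
  by move=> a [Aa]; rewrite -ball_normE => ya; exists a.
exists (4 * n%:R / r + 1) => [|x]; first by rewrite ltr_wpDl// divr_ge0// ltW.
have [->|x0'] := eqVneq x 0.
  by exists 0; rewrite linear0 subr0 !normr0 mulr0 mul0r.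
have nx : 0 < `|x| by rewrite normr_gt0.
pose k := r / 2 / `|x|.
have k0 : 0 < k by rewrite !divr_gt0.
have nkx : `|k *: x| = r / 2 by rewrite normrZ gtr0_norm// divfK// gt_eqF.
have [|a1 Aa1 a1x] := apx (k *: x); first by rewrite nkx ltr_pdivrMr// ltr_pMr// ltr1n.
have [|a2 Aa2 a2x] := apx 0; first by rewrite normr0.
have kV : k^-1 = `|x| * (2 / r) by rewrite /k !invfM invrK mulrC (mulrC r^-1) invrK.
exists (k^-1 *: (a1 - a2)); split.
  rewrite linearZ linearB normrZ gtr0_norm ?invr_gt0// kV -mulrA mulrC.
  rewrite ler_wpM2r// (@le_trans _ _ (2 / r * (n%:R + n%:R)))//.
    rewrite ler_wpM2l// ?divr_ge0 ?(ltW r0)//.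
    by rewrite (le_trans (ler_normB _ _))// lerD.
  have -> : 2 / r * (n%:R + n%:R) = 4 * n%:R / r by field; rewrite gt_eqF.
  by rewrite lerDl.
have -> : x - k^-1 *: (a1 - a2) = k^-1 *: ((x0 + k *: x - a1) - (x0 + 0 - a2)).
  rewrite -[in LHS](scalerK (lt0r_neq0 k0) x) -scalerBr; congr (_ *: _).
  by rewrite addr0 !opprB -[x0 + _ - a1]addrA [RHS]addrC addrA subrK addrCA.
rewrite normrZ gtr0_norm ?invr_gt0// kV.
rewrite (@le_trans _ _ (`|x| * (2 / r) * (r / 8 + r / 8)))//.
  rewrite ler_wpM2l ?mulr_ge0 ?invr_ge0 ?(ltW r0)//.
  by rewrite (le_trans (ler_normB _ _))// lerD// ltW.
by rewrite le_eqVlt; apply/orP; left; apply/eqP; field; rewrite gt_eqF.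
Qed.

Lemma proj_fun_bounded : exists M : R, forall x, `|p x| <= M * `|x|.
Proof.
have [C C0 /choice[a aP]] := proj_fun_approx.
exists (C * 2) => y.
pose r k := iter k (fun z => z - a z) y.
have rE k : r k.+1 = r k - a (r k) by [].
have r_le k : `|r k| <= `|y| * 2^-1 ^+ k.
  elim: k => [|k ih]; first by rewrite expr0 mulr1.
  rewrite rE (le_trans (proj2 (aP _)))// exprSr mulrA ler_wpM2r//.
pose u k : S := p (a (r k)).
have u_le k : `|u k| <= geometric (C * `|y|) 2^-1 k.
  rewrite (le_trans (proj1 (aP _)))//= -mulrA ler_wpM2l// ltW//.
have half1 : `|2^-1 : R| < 1 by rewrite gtr0_norm// invf_lt1// ltr1n.
have su k : series u k = p (y - r k).
  elim: k => [|k ih]; first by rewrite /series /= big_geq// subrr linear0.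
  rewrite seriesSr ih rE opprB (addrA y) (addrAC y).
  by rewrite [RHS](linearD p).
have /cvg_ex[l ul] : cvgn (series u).
  apply: normed_cvg.
  apply: (series_le_cvg _ _ _ (is_cvg_geometric_series (a := C * `|y|) half1)) => n.
  - exact: normr_ge0.
  - exact: le_trans (normr_ge0 (u n)) (u_le n).
  - exact: u_le.
have r0 : r @ \oo --> 0.
  apply/cvgr0Pnorm_le => e e0.
  have := cvg_geometric `|y| half1 => /cvgr0Pnorm_le/(_ e e0).
  apply: filterS => n /=; apply: le_trans.
  by rewrite (le_trans (r_le n))// ler_norm.
have yl : y - subspace_incl S l \in subspace_mem T.
  have h : (fun n => y - r n - subspace_incl S (series u n)) @ \oo -->
      y - subspace_incl S l.
    rewrite -[X in _ --> X - _](subr0 y); apply: cvgB.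
      by apply: cvgB => //; exact: cvg_cst.
    exact: continuous_cvg (@clin_continuous _ _ _ (subspace_incl S) l) ul.
  have := @closed_cvg _ _ _ _ _ _ (@subspace_closed _ _ T) _ _ h; apply.
  apply: nearW => n; have [t] := proj_funP (y - r n).
  by rewrite -su => {1}->; rewrite addrC addKr; exact: subspace_valP.
have -> : p y = l.
  by apply: (@proj_fun_uniq _ _ (SubspaceOf yl)); rewrite addrC subrK.
apply: (cvgr_to_le (cvg_norm ul)); apply: nearW => n.
rewrite (le_trans (ler_norm_sum _ _ _))//.
rewrite (@le_trans _ _ (series (geometric (C * `|y|) 2^-1) n))//.
  by rewrite ler_sum.
rewrite (le_trans (geometric_le_lim _ _ _ _))//.
  by rewrite mulr_ge0// ltW.
by rewrite le_eqVlt; apply/orP; left; apply/eqP; field.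
Qed.

Lemma proj_clin_pred : (p : V -> S) \in clin_pred V S.
Proof.
apply/asboolP; split; first exact: proj_fun_linear.
apply: (@bounded_linear_continuous _ _ _ (p : {linear V -> S})).
apply/linear_boundedP; have [M pM] := proj_fun_bounded; near=> r => x.
by rewrite (le_trans (pM x))// ler_wpM2r//; near: r; exact: nbhs_pinfty_ge.
Unshelve. all: by end_near. Qed.

Definition dsum_proj : clin V S := CLin proj_clin_pred.

End Projection.
End DirectSums.

Section Dual.
Context {R : realType}.

Lemma clin_comp_pred (U V W : normedModType R) (g : clin V W) (f : clin U V) :
  (g \o f : U -> W) \in clin_pred U W.
Proof.
apply/asboolP; split=> [a x y|x]; first by rewrite /= !linearP.
apply: continuous_comp; exact: clin_continuous.
Qed.

Definition clin_comp (U V W : normedModType R) (g : clin V W) (f : clin U V) :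
  clin U W := CLin (clin_comp_pred g f).

Definition cdual (V : normedModType R) := clin V R^o.

Definition dual_map (V W : normedModType R) (f : clin V W) (y : cdual W) :
  cdual V := clin_comp y f.

End Dual.

Section SmoothFunctions.
Context {R : realType}.

(* Frechet derivative, as a bounded operator; it is 'd f x wherever f is
   differentiable, and a default value elsewhere. *)
Definition fderiv (V W : normedModType R) (f : V -> W) (x : V) : clin V W :=
  insubd 0 ('d f x : V -> W).

(* The derivative of a C^(k+1) map V -> W is a C^k map into the space clin V W
   with its operator norm. *)
Fixpoint Ck (k : nat) (V W : normedModType R) (f : V -> W) : Prop :=
  if k is k'.+1 then (forall x, differentiable f x) /\ Ck k' (fderiv f)
  else continuous f.

Definition smooth (V : normedModType R) (f : V -> R^o) : Prop :=
  forall k, Ck k f.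

End SmoothFunctions.

Section BanachLie.
Context {R : realType} (g : completeNormedModType R).

Record banach_lie_bracket (br : g -> g -> g) : Prop := BanachLieBracket {
  lie_linearr : forall x, linear (br x);
  lie_linearl : forall y, linear (br^~ y);
  lie_alternating : forall x, br x x = 0;
  lie_jacobi : forall x y z, br x (br y z) + br y (br z x) + br z (br x y) = 0;
  lie_continuous : continuous (fun p : g * g => br p.1 p.2) }.

Record banach_lie_subalgebra (br : g -> g -> g) (A : set g) : Prop :=
  BanachLieSubalgebra {
    lie_sub0 : A 0;
    lie_sub_linear : forall (a : R) x y, A x -> A y -> A (a *: x + y);
    lie_sub_closed : closed A;
    lie_sub_bracket : forall x y, A x -> A y -> A (br x y) }.

End BanachLie.

Section BanachLiePoisson.
Context {R : realType} (b : completeNormedModType R).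
Variable br : cdual b -> cdual b -> cdual b.

(* blp_coad is ad^*_x b `<=` b, with b embedded in its bidual by evaluation. *)
Record banach_lie_poisson : Prop := BanachLiePoisson {
  blp_lie : banach_lie_bracket br;
  blp_coad : forall (x : cdual b) (v : b), exists w : b,
    forall y : cdual b, y w = br x y v }.

(* ad^*_x v as a vector of b: under blp_coad, the only w representing the
   functional y |-> <v, [x, y]> of the bidual. *)
Definition coad (x : cdual b) (v : b) : b :=
  xget 0 [set w | forall y : cdual b, y w = br x y v].

Definition poisson (f h : b -> R^o) : b -> R^o :=
  fun v => br (fderiv f v) (fderiv h v) v.

Definition poissonR (T : clin b b) (f h : b -> R^o) : b -> R^o :=
  fun v => (br (dual_map T (fderiv f v)) (fderiv h v) +
            br (fderiv f v) (dual_map T (fderiv h v))) v.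

Definition poisson_coind (S : normedModType R) (p : clin b S) (i : clin S b)
    (f h : S -> R^o) : S -> R^o :=
  poisson (f \o p) (h \o p) \o i.

Definition casimir (H : b -> R^o) : Prop :=
  smooth H /\ forall f, smooth f -> forall v, poisson f H v = 0.

End BanachLiePoisson.

Section Hamiltonian.
Context {R : realType} (V : normedModType R).
Variable bracket : (V -> R^o) -> (V -> R^o) -> (V -> R^o).

Definition in_involution (f h : V -> R^o) : Prop := forall v, bracket f h v = 0.

Definition is_hamiltonian_vf (h : V -> R^o) (X : V -> V) : Prop :=
  forall f, smooth f -> forall v, fderiv f v (X v) = bracket f h v.

End Hamiltonian.

(* Main.v *)
(* Testing {f, H} = 0 on the linear functions f = y gives <[y, DH(v)], v> = 0
   for every y in the dual, i.e. DH(v) brackets to zero against everything when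
   evaluated at v; this kills both terms of {F, H}_R.  For v in b_1 one has
   D(H o R_1)(v) = R_1^* DH(v) = DH(v) - R_2^* DH(v), so inside a bracket
   evaluated at v the covector R_1^* DH(v) may be replaced by - R_2^* DH(v).
   Done in one slot, this gives the Hamiltonian vector field; done in both, it
   gives involution, since [R_2^* x, R_2^* y] lies in im R_2^*, whose elements
   vanish on b_1. *)
Require Import Defs.
From HB Require Import structures.
From mathcomp Require Import all_boot all_order all_algebra.
From mathcomp Require Import all_classical all_reals all_analysis.

Set Implicit Arguments.
Unset Strict Implicit.
Unset Printing Implicit Defensive.

Import Order.TTheory GRing.Theory Num.Theory.
Import numFieldNormedType.Exports.

Local Open Scope classical_set_scope.
Local Open Scope ring_scope.

Section FrechetDerivative.
Context {R : realType}.
Implicit Types U V W : normedModType R.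

Lemma clin_addE V W (f g : clin V W) x : (f + g) x = f x + g x.
Proof. by []. Qed.

Lemma clin_oppE V W (f : clin V W) x : (- f) x = - f x.
Proof. by []. Qed.

(** At a point of differentiability the differential is linear and continuous, so [insubd] does not
    fall back on its default 0. *)
Lemma fderivE V W (f : V -> W) x : differentiable f x ->
  fderiv f x = 'd f x :> (V -> W).
Proof.
move=> df; have dP : ('d f x : V -> W) \in clin_pred V W.
  by apply/asboolP; split; [exact: linearP|exact: diff_continuous].
exact: (insubdK (0 : clin V W) dP).
Qed.

Lemma clin_differentiable V W (y : clin V W) x : differentiable y x.
Proof. exact/linear_differentiable/clin_continuous. Qed.

Lemma fderiv_clin V W (y : clin V W) x : fderiv y x = y.
Proof.
apply/clinP => u; rewrite fderivE; last exact: clin_differentiable.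
by rewrite diff_lin//; exact: clin_continuous.
Qed.

Lemma fderiv_comp_clin U V W (g : V -> W) (f : clin U V) x :
  differentiable g (f x) -> fderiv (g \o f) x = clin_comp (fderiv g (f x)) f.
Proof.
move=> dg; have df := clin_differentiable f x.
apply/clinP => u; rewrite fderivE; last exact: differentiable_comp.
by rewrite diff_comp//= diff_lin ?fderivE//; exact: clin_continuous.
Qed.

(** The codomain varies in the induction: the derivative is again constant, but with values in
    [clin V W]. *)
Lemma Ck_cst k V W (c : W) : Ck k (fun _ : V => c).
Proof.
elim: k V W c => [|k IH] V W c /=; first exact: cst_continuous.
split=> [x|]; first exact: differentiable_cst.
rewrite (_ : fderiv _ = fun=> 0)//; apply/funext => x; apply/clinP => u.
by rewrite fderivE ?diff_cst//; exact: differentiable_cst.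
Qed.

(** This admits the elements of the dual as test functions in [casimir]. *)
Lemma smooth_clin V (y : cdual V) : smooth y.
Proof.
case=> [|k] /=; first exact: clin_continuous.
split=> [x|]; first exact: clin_differentiable.
rewrite (_ : fderiv _ = fun=> y); first exact: Ck_cst.
by apply/funext => x; exact: fderiv_clin.
Qed.

Lemma smooth_differentiable V (f : V -> R^o) x : smooth f -> differentiable f x.
Proof. by move=> /(_ 1%N)[]. Qed.

End FrechetDerivative.

Section LieBracket.
Context {R : realType} (g : completeNormedModType R) (br : g -> g -> g).
Hypothesis brP : banach_lie_bracket br.

Lemma lie_bracketDl x y z : br (x + y) z = br x z + br y z.
Proof. by have := lie_linearl brP z 1 x y; rewrite !scale1r. Qed.

Lemma lie_bracketDr x y z : br z (x + y) = br z x + br z y.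
Proof. by have := lie_linearr brP z 1 x y; rewrite !scale1r. Qed.

Lemma lie_bracketC x y : br x y = - br y x.
Proof.
apply/eqP; rewrite -addr_eq0; apply/eqP.
(* Polarisation: expand [x + y, x + y] = 0. *)
have := lie_alternating brP (x + y).
by rewrite lie_bracketDl !lie_bracketDr !lie_alternating// add0r addr0.
Qed.

End LieBracket.

Section CasimirFunctions.
Context {R : realType} (b : completeNormedModType R).
Context (br : cdual b -> cdual b -> cdual b).
Hypothesis brP : banach_lie_poisson br.
Implicit Types F H : b -> R^o.

Lemma casimir_br H (y : cdual b) v : casimir br H -> br y (fderiv H v) v = 0.
Proof.
by move=> [_ /(_ y (smooth_clin y) v)]; rewrite /poisson fderiv_clin.
Qed.

(** [blp_coad] supplies a representing vector, so [xget] returns one rather than its default 0. *)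
Lemma coadE (x y : cdual b) v : y (coad br x v) = br x y v.
Proof.
by move: y; exact: (xgetPex 0 (blp_coad brP x v)).
Qed.

(** Each term vanishes separately, the first because H is a Casimir function, the second, after
    antisymmetry, because F is. *)
Lemma casimir_involutionR (T : clin b b) F H : casimir br F -> casimir br H ->
  in_involution (poissonR br T) F H.
Proof.
move=> cF cH v; rewrite /poissonR (lie_bracketC (blp_lie brP) (fderiv F v)).
have := casimir_br (dual_map T (fderiv F v)) v cH.
have := casimir_br (dual_map T (fderiv H v)) v cF.
(* Otherwise rewriting compares the two derivatives up to conversion. *)
move: (fderiv F v) (fderiv H v) => x y xT yT.
by rewrite clin_addE clin_oppE xT yT subrr.
Qed.

(* S stands for b_j, and Q for the projector onto the other summand. *)
Context (S : normedModType R) (p : clin b S) (i : clin S b) (Q : clin b b).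
Hypothesis iK : cancel i p.
Hypothesis Qi : forall s, Q (i s) = 0.
Hypothesis pQ : forall v, i (p v) + Q v = v.

Let T : clin b b := clin_comp i p.

Lemma dual_map_split (y : cdual b) : dual_map T y + dual_map Q y = y.
Proof.
by apply/clinP => v; rewrite -[LHS]/(y (i (p v)) + y (Q v)) -linearD pQ.
Qed.

Lemma casimir_brT H (y : cdual b) v : casimir br H ->
  br y (dual_map T (fderiv H v)) v = - br y (dual_map Q (fderiv H v)) v.
Proof.
move=> cH; apply/eqP; rewrite -addr_eq0.
rewrite -clin_addE -(lie_bracketDr (blp_lie brP)) dual_map_split.
by rewrite (casimir_br _ _ cH).
Qed.

(** Common source of the involution and of the vector field: the chain rule puts [dual_map T] on the
    derivative of H, and [casimir_brT] trades it for [dual_map Q]. *)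
Lemma poisson_coind_casimir (f : S -> R^o) H s :
  differentiable f s -> casimir br H ->
  poisson_coind br p i f (H \o i) s =
  - br (dual_map p (fderiv f s)) (dual_map Q (fderiv H (i s))) (i s).
Proof.
move=> df cH; rewrite -(casimir_brT _ _ cH) /poisson_coind /poisson /=.
rewrite (fderiv_comp_clin (f := p)) iK//.
rewrite (_ : (H \o i) \o p = H \o T)// fderiv_comp_clin /= iK//.
by apply: smooth_differentiable; case: cH.
Qed.

Lemma casimir_involution_coind F H :
  banach_lie_subalgebra br (range (dual_map Q)) ->
  casimir br F -> casimir br H ->
  in_involution (poisson_coind br p i) (F \o i) (H \o i).
Proof.
move=> subQ cF cH s.
have dF : differentiable F (i s) by apply: smooth_differentiable; case: cF.
rewrite poisson_coind_casimir//; last first.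
  by apply: differentiable_comp => //; exact: clin_differentiable.
rewrite fderiv_comp_clin//.
rewrite (_ : dual_map p _ = dual_map T (fderiv F (i s))); last exact/clinP.
rewrite (lie_bracketC (blp_lie brP)).
rewrite clin_oppE opprK (casimir_brT _ _ cF).
(* Both slots now lie in the range of Q^*, hence so does the bracket: it is Q^* z, which vanishes at
   [i s]. *)
have [z _ <-] := lie_sub_bracket subQ (imageT _ (fderiv H (i s)))
  (imageT _ (fderiv F (i s))).
by rewrite -[dual_map Q z (i s)]/(z (Q (i s))) Qi linear0 oppr0.
Qed.

Lemma casimir_hamiltonian_coind H : casimir br H ->
  is_hamiltonian_vf (poisson_coind br p i) (H \o i)
    (fun s => p (coad br (dual_map Q (fderiv H (i s))) (i s))).
Proof.
move=> cH f sf s; rewrite poisson_coind_casimir//; last first.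
  exact: smooth_differentiable.
rewrite (lie_bracketC (blp_lie brP)) clin_oppE opprK.
(* Pairing Df with [p w] is by conversion pairing p^* Df with w, here the coadjoint vector. *)
by rewrite -coadE.
Qed.

End CasimirFunctions.

Section SplittingProjections.
Context {R : realType} (V : completeNormedModType R) (S T : closed_subspace V).
Variable ST : direct_sum S T.

Lemma dsum_proj_inclK : cancel (subspace_incl S) (dsum_proj ST).
Proof.
by move=> s; apply: (@proj_fun_uniq _ _ _ _ _ _ _ 0); rewrite linear0 addr0.
Qed.

Lemma dsum_proj_incl t : dsum_proj ST (subspace_incl T t) = 0.
Proof.
by apply: (@proj_fun_uniq _ _ _ _ _ _ _ t); rewrite linear0 add0r.
Qed.

Lemma dsum_proj_split x : subspace_incl S (dsum_proj ST x) +
  subspace_incl T (dsum_proj (direct_sumC ST) x) = x.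
Proof.
have [t xE] := proj_funP ST x.
rewrite [in RHS]xE; congr (_ + subspace_incl T _).
(* By uniqueness in the swapped splitting, the projection to T is t. *)
by apply: (@proj_fun_uniq _ _ _ _ _ _ _ (proj_fun ST x)); rewrite addrC.
Qed.

End SplittingProjections.

Theorem corollary2p3 (R : realType) (b : completeNormedModType R)
    (br : cdual b -> cdual b -> cdual b) (b1 b2 : closed_subspace b)
    (spl : direct_sum b1 b2) :
  let pi1 : clin b b1 := dsum_proj spl in
  let pi2 : clin b b2 := dsum_proj (direct_sumC spl) in
  let iota1 : clin b1 b := subspace_incl b1 in
  let iota2 : clin b2 b := subspace_incl b2 in
  let R1 : clin b b := clin_comp iota1 pi1 in
  let R2 : clin b b := clin_comp iota2 pi2 in
  let RR : clin b b := 2^-1 *: (R1 - R2) in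
  let coind1 := poisson_coind br pi1 iota1 in
  let coind2 := poisson_coind br pi2 iota2 in
  banach_lie_poisson br ->
  banach_lie_subalgebra br (range (dual_map R1)) ->
  banach_lie_subalgebra br (range (dual_map R2)) ->
  (forall F H : b -> R^o, casimir br F -> casimir br H ->
     [/\ in_involution (poissonR br RR) F H,
         in_involution coind1 (F \o iota1) (H \o iota1)
       & in_involution coind2 (F \o iota2) (H \o iota2)]) /\
  (forall H : b -> R^o, casimir br H ->
     is_hamiltonian_vf coind1 (H \o iota1) (fun v1 : b1 =>
       pi1 (coad br (dual_map R2 (fderiv H (iota1 v1))) (iota1 v1))) /\
     is_hamiltonian_vf coind2 (H \o iota2) (fun v2 : b2 =>
       pi2 (coad br (dual_map R1 (fderiv H (iota2 v2))) (iota2 v2)))).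
Proof.
move=> pi1 pi2 iota1 iota2 R1 R2 RR coind1 coind2 brP sub1 sub2.
have i1K : cancel iota1 pi1 := dsum_proj_inclK spl.
have i2K : cancel iota2 pi2 := dsum_proj_inclK (direct_sumC spl).
have R2i1 s : R2 (iota1 s) = 0.
  by rewrite -[LHS]/(iota2 (pi2 (iota1 s))) (dsum_proj_incl (direct_sumC spl)) linear0.
have R1i2 s : R1 (iota2 s) = 0.
  by rewrite -[LHS]/(iota1 (pi1 (iota2 s))) dsum_proj_incl linear0.
have R12 v : iota1 (pi1 v) + R2 v = v := dsum_proj_split spl v.
have R21 v : iota2 (pi2 v) + R1 v = v by rewrite addrC; exact: R12.
(* On b_1 the complementary projector Q is R_2, on b_2 it is R_1. *)
split=> [F H cF cH|H cH].
  split; first exact: casimir_involutionR.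
    exact: (casimir_involution_coind brP i1K R2i1 R12 sub2).
  exact: (casimir_involution_coind brP i2K R1i2 R21 sub1).
split; first exact: (casimir_hamiltonian_coind brP i1K R12).
exact: (casimir_hamiltonian_coind brP i2K R21).
Qed.
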